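(* Let $\mathcal H$ be a real Hilbert space, let $A:\mathcal H\to2^{\mathcal H}$ be set-valued, let $C:\mathcal H\to\mathcal H$ be $\beta$-cocoercive with $\beta>0$, let $D:\mathcal H\to\mathcal H$ be $\vartheta$-Lipschitzian with $\vartheta\ge0$, and suppose $\operatorname{zer}(A+C+D)\ne\varnothing$. Let $\rho_A\in\mathbb R$ and $\nu_A\in[0,+\infty[$, and suppose that (a) $A+D$ is $(\nu_A,\rho_A)$-semimonotone on $\{(x^*,-Cx^* ): -Cx^*\in(A+D)x^*\}$; (b) there is $\Omega_A\subset\,]0,+\infty[$ such that, for every $\tau\in\Omega_A$, $J_{\tau A}$ is single-valued and has full domain; (c) $\operatorname{gra}(A+D+C)$ is sequentially weak-strong closed. Let $\tau\in\Omega_A$, $\theta\in\,]0,2[$, $\hat\rho=\min(0,\rho_A)$, let $(z_0,p_0,z_{-1})\in\mathcal H^3$, set $y_{-1}=Dz_{-1}$, and let $(z_n)_{n\ge1}$ be generated by $$(\forall n\in\mathbb N)\quad\left\lfloor\begin{aligned}&y_n=Dz_n\\&x_n=z_n-\tau(y_n-y_{n-1}+Dp_n+Cz_n)\\&p_{n+1}=J_{\tau A}x_n\\&z_{n+1}=(1-\theta)z_n+\theta p_{n+1}.\end{aligned}\right.$$ Let $\eta_\theta=1$ if $\theta\in[1,2[$ and $D$ is monotone, and $\eta_\theta=1+|1-\theta|$ otherwise. Assume that $$\gamma=\beta+\hat\rho(1+\vartheta)>0\qquad\text{and}\qquad b_2\tau^2+b_1\tau+b_0>0,$$ where $$b_0=4\hat\rho(\gamma-\hat\rho),\quad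 b_1=2\left(\gamma(2-\theta+8\hat\rho\vartheta)-2\hat\rho\right),\quad b_2=16\gamma\hat\rho\vartheta(1+\vartheta)-4\gamma\vartheta\eta_\theta-1.$$ Then: (i) $(z_n)_{n\in\mathbb N}$ converges weakly to some $z\in\operatorname{zer}(A+C+D)$; (ii) if $\nu_A>0$, then $(z_n)_{n\in\mathbb N}$ converges R-linearly to the unique $z\in\operatorname{zer}(A+C+D)$.
   Context: $J_E=(\mathrm{Id}+E)^{-1}$, $\operatorname{zer}E=\{x:0\in Ex\}$, $\operatorname{gra}E=\{(x,u):u\in Ex\}$. $C$ is $\beta$-cocoercive if $\langle x-y,Cx-Cy\rangle\ge\beta\|Cx-Cy\|^2$ for all $x,y$. For $(\mu,\rho)\in\mathbb R^2$ and $\mathcal S\subset\mathcal H^2$, a set-valued operator $E$ is $(\mu,\rho)$-semimonotone on $\mathcal S$ if $\langle x-y,u-v\rangle\ge\mu\|x-y\|^2+\rho\|u-v\|^2$ for all $(y,v)\in\mathcal S$ and $(x,u)\in\operatorname{gra}E$. A graph is sequentially weak-strong closed if $(x_n,u_n)$ in the graph, $x_n\rightharpoonup x$, $u_n\to u$ imply $(x,u)$ in the graph. R-linear convergence of $(z_n)$ to $z$: $\|z_n-z\|\le c\,r^n$ for some $c\ge0$, $r\in\,]0,1[$. *)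

(* Defs.v *)
From HB Require Import structures.
From mathcomp Require Export all_boot all_order all_algebra.
From mathcomp Require Export sesquilinear.
From mathcomp Require Export all_classical all_reals all_analysis.
Export numFieldNormedType.Exports.
Import Order.TTheory GRing.Theory Num.Theory.

Set Implicit Arguments.
Unset Strict Implicit.
Unset Printing Implicit Defensive.

Local Open Scope classical_set_scope.
Local Open Scope ring_scope.

Section SetValuedOperators.
Context {R : realType} {H : completeNormedModType R}.
Implicit Types (E F : H -> set H) (f : H -> H).

Definition op_of f : H -> set H := fun x => [set f x].

Definition opadd E F : H -> set H :=
  fun x => [set u + v | u in E x & v in F x].

Definition opscale (t : R) E : H -> set H := fun x => [set t *: u | u in E x].

Definition opinv E : H -> set H := fun u => [set x | E x u].

Definition zer E : set H := [set x | E x 0].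

Definition gra E : set (H * H) := [set xu | E xu.1 xu.2].

Definition opdom E : set H := [set x | E x !=set0].

Definition single_valued E : Prop := forall x, is_subset1 (E x).

Definition resolvent E : H -> set H := opinv (opadd (op_of id) E).

End SetValuedOperators.

Section HilbertNotions.
Context {R : realType} {H : completeNormedModType R}.
Variable dot : {dot H for (@idfun R)}.

(* Together with the completeness carried by [H], this makes [(H, dot)] a real
   Hilbert space: [dot] is bilinear, symmetric and positive definite by its
   type. *)
Definition hilbert_dot : Prop := forall x : H, dot x x = `|x| ^+ 2.

Definition cocoercive (beta : R) (C : H -> H) : Prop :=
  forall x y : H, beta * `|C x - C y| ^+ 2 <= dot (x - y) (C x - C y).

Definition monotone (D : H -> H) : Prop :=
  forall x y : H, 0 <= dot (x - y) (D x - D y).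

Definition semimonotone_on (mu rho : R) (E : H -> set H) (S : set (H * H)) :
    Prop :=
  forall y v x u : H, S (y, v) -> gra E (x, u) ->
    mu * `|x - y| ^+ 2 + rho * `|u - v| ^+ 2 <= dot (x - y) (u - v).

Definition weak_cvg (x : nat -> H) (l : H) : Prop :=
  forall w : H, (fun n => dot (x n) w) @ \oo --> dot l w.

Definition seq_weak_strong_closed (G : set (H * H)) : Prop :=
  forall (x u : nat -> H) (xl ul : H),
    (forall n, G (x n, u n)) -> weak_cvg x xl -> u @ \oo --> ul -> G (xl, ul).

Definition eta (D : H -> H) (theta : R) : R :=
  if `[< 1 <= theta < 2 /\ monotone D >] then 1 else 1 + `|1 - theta|.

End HilbertNotions.

Definition Rlinear_cvg {R : realType} {H : completeNormedModType R}
    (z : nat -> H) (l : H) : Prop :=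
  exists c r : R, [/\ 0 <= c, 0 < r < 1 &
    forall n, `|z n - l| <= c * r ^+ n].

(* The term of index [n - 1] of a sequence started at index [-1] with the value
   [am1]. *)
Definition prev_term {T : Type} (am1 : T) (a : nat -> T) (n : nat) : T :=
  if n is m.+1 then a m else am1.

(* Main.v *)
Require Import Defs.
From mathcomp Require Import ring lra.
Import Order.TTheory GRing.Theory Num.Theory.

(* With e_n = z_n - z*, d_n = z_(n-1) - p_n and g_n = D z_(n-1) - D p_n, the
   vector d_(n+1) / tau + g_n - g_(n+1) - C z_n belongs to (A + D) p_(n+1).
   Semimonotonicity at z*, cocoercivity of C and |g_n| <= vartheta |d_n| make
     |e_n|^2 + 2 theta tau <e_n, g_n> + theta m |d_n|^2
   decrease by at least theta kappa |d_(n+1)|^2 + 2 tau theta nu_A |p_(n+1) - z*|^2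
   for a suitable m, where kappa is the quadratic b_2 tau^2 + b_1 tau + b_0
   divided by 2 gamma tau. This functional dominates |e_n|^2 / 2, so z_n is
   bounded, d_n tends to 0 and |e_n| converges; Opial's argument gives (i). When
   nu_A > 0 the decrease is a fixed fraction of the functional, whence (ii).
   Weak sequential compactness of bounded sequences in a possibly nonseparable
   space comes from an ultrafilter limit of the scalars <z_n, z_m> and a Riesz
   vector in the closed subspace of the w for which <z_(s k), w> converges. *)

Set Implicit Arguments.
Unset Strict Implicit.
Unset Printing Implicit Defensive.

Local Open Scope classical_set_scope.
Local Open Scope ring_scope.

(** Parallelogram identity for the functional minimised in [riesz_subspace]: with [c] the squared
    distance of two points, the mean of their values exceeds the midpoint value by [c / 4], and the
    midpoint value is at least the infimum [m]. *)
Lemma midpoint_gap (R : realFieldType) (fn fk m d c an ak : R) :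
  fn < m + an -> fk < m + ak -> fn = fk + 2 * 1 * d + 1 ^+ 2 * c ->
  m <= fk + 2 * 2^-1 * d + 2^-1 ^+ 2 * c -> c <= 2 * (an + ak).
Proof. by rewrite divff ?pnatr_eq0//; lra. Qed.

Lemma add_quarters (R : realFieldType) (a b c : R) :
  b < c / 4 -> a < c / 4 -> 2 * (a + b) < c.
Proof. lra. Qed.

Lemma gap_ge0 (R : realFieldType) (f m a c d : R) :
  f < m + a -> m <= f + c + d -> 0 <= a + c + d.
Proof. lra. Qed.

(** * Cauchy-Schwarz, Riesz representation and weak sequential compactness *)

Section Hilbert.
Context {R : realType} {H : completeNormedModType R}.
Context (dot : {dot H for (@idfun R)}).

Lemma dotC x y : dot x y = dot y x.
Proof. by rewrite hermC /= expr0 mul1r. Qed.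

Lemma dotDl x y w : dot (x + y) w = dot x w + dot y w.
Proof. exact: linearDl. Qed.

Lemma dotDr x y w : dot w (x + y) = dot w x + dot w y.
Proof. exact: linearDr. Qed.

Lemma dotNl x y : dot (- x) y = - dot x y.
Proof. exact: linearNl. Qed.

Lemma dotNr x y : dot x (- y) = - dot x y.
Proof. exact: linearNr. Qed.

Lemma dotZl a x y : dot (a *: x) y = a * dot x y.
Proof. by rewrite linearZl_LR. Qed.

Lemma dotZr a x y : dot x (a *: y) = a * dot x y.
Proof. by rewrite linearZr_LR. Qed.

Lemma dot0l x : dot 0 x = 0.
Proof. exact: linear0l. Qed.

Definition dotE := (dotDl, dotDr, dotNl, dotNr, dotZl, dotZr).

Hypothesis hdot : hilbert_dot dot.

Lemma dot_ge0 x : 0 <= dot x x.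
Proof. by rewrite hdot sqr_ge0. Qed.

Lemma norm_dot_le x y : `|dot x y| <= `|x| * `|y|.
Proof.
have half u v : dot u v <= `|u| * `|v|.
  have [->|u0] := eqVneq u 0; first by rewrite dot0l normr0 mul0r.
  have [->|v0] := eqVneq v 0; first by rewrite dotC dot0l normr0 mulr0.
  have uv : 0 < `|u| * `|v| by rewrite mulr_gt0 ?normr_gt0.
  have := dot_ge0 (`|v| *: u - `|u| *: v).
  rewrite !dotE (dotC v u) !hdot => h.
  by rewrite -(ler_pM2l uv); lra.
rewrite ler_norml half andbT lerNl.
by rewrite -dotNl (le_trans (half _ _))// normrN.
Qed.

Lemma dot_ler x y : dot x y <= `|x| * `|y|.
Proof. exact: le_trans (ler_norm _) (norm_dot_le _ _). Qed.

Lemma dot_cvg (u : nat -> H) l w : u @ \oo --> l -> dot (u n) w @[n --> \oo] --> dot l w.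
Proof.
move=> /cvgrPdist_lt ul; apply/cvgrPdist_lt => e e0.
have d0 : 0 < e / (`|w| + 1) by rewrite divr_gt0// ltr_wpDl.
apply: filterS (ul _ d0) => n; rewrite ltr_pdivlMr ?ltr_wpDl// => h.
rewrite -dotNl -dotDl (le_lt_trans (norm_dot_le _ _))// (le_lt_trans _ h)//.
by rewrite ler_wpM2l// lerDl.
Qed.

(* The Riesz vector minimises [`|v|^2 / 2 - l v]; a minimising sequence is
   Cauchy by the parallelogram identity. *)
Lemma riesz_subspace (W : set H) (l : H -> R) (M : R) :
    W 0 -> (forall a x y, W x -> W y -> W (x + a *: y)) -> closed W ->
    (forall a x y, W x -> W y -> l (x + a *: y) = l x + a * l y) ->
    (forall x, W x -> `|l x| <= M * `|x|) ->
  exists2 v, W v & forall w, W w -> dot v w = l w.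
Proof.
move=> W0 WD Wcl lD lM.
pose F v := dot v v - 2 * l v.
have Flb v : W v -> - M ^+ 2 <= F v.
  move=> Wv; rewrite /F hdot.
  have := lM _ Wv; rewrite ler_norml => /andP[_ h].
  have := sqr_ge0 (`|v| - M); nra.
pose E := F @` W.
have infE : has_inf E.
  split; first by exists (F 0), 0.
  by exists (- M ^+ 2) => _ [v Wv <-]; exact: Flb.
pose m := inf E.
have mF v : W v -> m <= F v.
  by move=> Wv; apply: ge_inf; [case: infE|exists v].
have FD a x y : W x -> W y ->
    F (x + a *: y) = F x + 2 * a * (dot x y - l y) + a ^+ 2 * dot y y.
  by move=> Wx Wy; rewrite /F lD// !dotE (dotC y x); ring.
have /choice[v vP] (n : nat) : exists v, W v /\ F v < m + n.+1%:R^-1.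
  have n0 : 0 < n.+1%:R^-1 :> R by rewrite invr_gt0.
  by have [_ [v Wv <-] ?] := inf_adherent n0 infE; exists v.
have close n k : `|v n - v k| ^+ 2 <= 2 * (n.+1%:R^-1 + k.+1%:R^-1).
  have [Wn Fn] := vP n; have [Wk Fk] := vP k.
  have Wd : W (v n - v k) by rewrite -scaleN1r; exact: WD.
  have := mF _ (WD 2^-1 _ _ Wk Wd); rewrite FD// -hdot.
  have := FD 1 _ _ Wk Wd; rewrite scale1r [v k + _]addrC subrK.
  exact: midpoint_gap.
have cv : cvgn v.
  apply/cauchy_cvgP/cauchy_exP => e e0.
  have e20 : 0 < e ^+ 2 / 4 by rewrite divr_gt0// exprn_gt0.
  have [N _ hN] := near_infty_natSinv_lt (PosNum e20).
  exists (v N); exists N => // n /= Nn; rewrite -ball_normE /=.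
  have := hN N (leqnn N); have := hN n Nn; rewrite /= => h1 h2.
  rewrite -(@ltr_pXn2r _ 2)// ?nnegrE ?(ltW e0)//.
  exact: le_lt_trans (close N n) (add_quarters h1 h2).
have {cv} vv := cv; set u := limn v in vv.
have Wu : W u.
  by apply: (@closed_cvg _ _ _ _ v W Wcl _ u vv); near=> n; have [] := vP n.
exists u => // w Ww; set t := dot u w - l w.
(* Perturbing [v n] by [a *: w] cannot go below [m]; the limit in [n] gives the optimality condition
   at [u]. *)
have quad a : 0 <= 2 * a * t + a ^+ 2 * dot w w.
  have cl : n.+1%:R^-1 + 2 * a * (dot (v n) w - l w) + a ^+ 2 * dot w w
      @[n --> \oo] --> 0 + 2 * a * t + a ^+ 2 * dot w w.
    apply: cvgD; last exact: cvg_cst.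
    apply: cvgD; first exact: cvg_harmonic.
    by apply: cvgMr; apply: cvgB; [exact: dot_cvg|exact: cvg_cst].
  rewrite -[X in 0 <= X + _]add0r -(cvg_lim _ cl)//; apply: limr_ge.
    by apply/cvg_ex; eexists; exact: cl.
  near=> n; have [Wn Fn] := vP n.
  have := mF _ (WD a _ _ Wn Ww); rewrite FD//; exact: gap_ge0.
have s1 : 0 < dot w w + 1 by rewrite ltr_wpDl ?dot_ge0.
(* The [+ 1] keeps the denominator positive when [w = 0]. With s = <w, w>, the quadratic takes the
   value -t^2 (s + 2) / (s + 1)^2 there, so t = 0. *)
have := quad (- t / (dot w w + 1)).
rewrite -(pmulr_rge0 _ (exprn_gt0 2 s1)).
set s := dot w w in s1 *.
have -> : (s + 1) ^+ 2 * (2 * (- t / (s + 1)) * t + (- t / (s + 1)) ^+ 2 * s) =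
    - (t ^+ 2 * (s + 2)) by field; rewrite gt_eqF.
rewrite oppr_ge0 pmulr_lle0; last by lra.
by rewrite exprn_even_le0//= subr_eq0 => /eqP.
Unshelve. all: by end_near. Qed.


(** Compactness of the segment gives a cluster point. For an ultrafilter it is a limit: otherwise
    the complement of the preimage of some neighbourhood would belong to [U]. *)
Lemma ultra_bounded_cvg (f : nat -> R) (U : set_system nat) (M : R) :
  UltraFilter U -> (forall n, `|f n| <= M) -> exists c : R, f @ U --> c.
Proof.
move=> UU fM; have PU : ProperFilter U by exact: ultra_proper.
have [|c [_ cl]] := @segment_compact R (- M) M (fmap f U) _.
  by apply: (@filterE _ U) => n; rewrite /= in_itv /= -ler_norml; exact: fM.
exists c => B cB; have [//|UB] := in_ultra_setVsetC (f @^-1` B) UU.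
by have [_ [[n Bn <-]//]] := cl (f @` (f @^-1` (~` B))) B
  (filterS (@preimage_image _ _ _ _) UB) cB.
Qed.

(** All the scalars <z_n, z_m> converge at once along the ultrafilter, which replaces a diagonal
    extraction: [s k] serves every m <= k with error 1/(k+1). The bound [k <= s k] already carries
    limits at infinity along [s]. *)
Lemma weak_seq_compact (z : nat -> H) (M : R) : (forall n, `|z n| <= M) ->
  exists (s : nat -> nat) (l : H),
    (forall k, (k <= s k)%N) /\ weak_cvg dot (z \o s) l.
Proof.
move=> zM.
have M0 : 0 <= M by exact: le_trans (zM 0%N).
have [U [UU oU]] := ultraFilterLemma eventually_filter.
have PU : ProperFilter U by exact: ultra_proper.
have /choice[c cP] (m : nat) : exists c : R, dot (z n) (z m) @[n --> U] --> c.
  apply: (@ultra_bounded_cvg _ _ (M * M)) => // n.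
  by rewrite (le_trans (norm_dot_le _ _))// ler_pM.
have /choice[s sP] (k : nat) : exists n, (k <= n)%N /\
    forall m : 'I_k.+1, `|c m - dot (z n) (z m)| < k.+1%:R^-1.
  apply: (@filter_ex _ U); apply: filterI; first exact/oU/nbhs_infty_ge.
  apply: filter_forall => m; have /cvgrPdist_lt := cP m; apply.
  by rewrite invr_gt0.
pose y k := z (s k).
have yM k : `|y k| <= M by exact: zM.
(* A closed subspace containing every [z m], on which the limit functional is defined and bounded by
   [M]. *)
pose W : set H := [set w | cvgn (fun k => dot (y k) w)].
have Wz m : W (z m).
  apply/cvg_ex; exists (c m); apply/cvgrPdist_lt => e e0.
  have [N _ hN] := near_infty_natSinv_lt (PosNum e0).
  exists (maxn N m) => // k; rewrite /= geq_max => /andP[Nk mk].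
  by have [_ /(_ (Ordinal (mk : (m < k.+1)%N)))/lt_trans] := sP k; apply; exact: hN.
have Wadd a u v : W u -> W v ->
    dot (y k) (u + a *: v) @[k --> \oo] -->
      limn (fun k => dot (y k) u) + a * limn (fun k => dot (y k) v).
  move=> Wu Wv; under eq_fun do rewrite dotDr dotZr.
  by apply: cvgD => //; exact: cvgMr.
have Wcl : closed W.
  move=> w clw; apply/cauchy_cvgP/cauchy_exP => e e0.
  have d0 : 0 < e / 2 / (M + 1) by rewrite !divr_gt0// ltr_wpDl.
  have [w' [/cvg_ex[l /cvgrPdist_lt hl]]] := clw _ (nbhsx_ballx w _ d0).
  rewrite -ball_normE /= ltr_pdivlMr ?ltr_wpDl// => ww'.
  exists l; apply: filterS (hl _ (divr_gt0 e0 (ltr0Sn _ 1))) => k hk.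
  rewrite -ball_normE /=.
  have -> : l - dot (y k) w = (l - dot (y k) w') + dot (y k) (w' - w).
    by rewrite !dotE addrA subrK.
  rewrite (le_lt_trans (ler_normD _ _))// (splitr e) ltr_leD//.
  rewrite (le_trans (norm_dot_le _ _))// distrC mulrC ltW// (le_lt_trans _ ww')//.
  by rewrite ler_wpM2l// (le_trans (yM k))// lerDl.
have W0 : W 0 by rewrite /W /=; under eq_fun do rewrite dotC dot0l; exact: is_cvg_cst.
have WD a u v : W u -> W v -> W (u + a *: v).
  by move=> Wu Wv; apply/cvg_ex; eexists; exact: Wadd.
have [v Wv vP] : exists2 v, W v & forall w, W w -> dot v w = limn (fun k => dot (y k) w).
  apply: (@riesz_subspace W _ M) => //.
    by move=> a u w Wu Ww; apply/cvg_lim => //; exact: Wadd.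
  move=> w Ww;
  have /cvg_norm nw : dot (y k) w @[k --> \oo]
      --> limn (fun k => dot (y k) w) by [].
  rewrite -(cvg_lim _ nw)//; apply: limr_le; first by apply/cvg_ex; eexists; exact: nw.
  by near=> k; rewrite (le_trans (norm_dot_le _ _))// ler_wpM2r.
exists s, v; split=> [k|w]; first by have [] := sP k.
(* [w'] is the orthogonal projection of [w] on [W]. Both [v] and the [y k] lie in [W], so testing
   against [w] amounts to testing against [w']. *)
have [w' Ww' w'P] : exists2 w', W w' & forall u, W u -> dot w' u = dot w u.
  apply: (@riesz_subspace W _ `|w|) => //.
    by move=> a u t _ _; rewrite dotDr dotZr.
  by move=> u _; exact: norm_dot_le.
rewrite dotC -w'P// dotC vP//.
have -> : (fun n => dot ((z \o s) n) w) = (fun n => dot (y n) w').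
  by apply/funext => n; rewrite dotC -w'P ?(dotC w')//; exact: Wz.
exact: Ww'.
Unshelve. all: by end_near. Qed.


End Hilbert.

(** * Scalar form of the one-step decrease and of the step-size condition *)

Section Rate.
Context {R : realFieldType} (tau theta r gamma vt et : R).

(** The weight m of the functional; [r] stands for -rhohat, [vt] for vartheta and [et] for eta. It
    collects what the bounds on g_n cost in |d_n|^2. *)
Definition memory_weight : R :=
  tau * vt + 2 * r * vt + 4 * tau * r * vt * (1 + vt).

(** The kappa of the decrease: what is left of the weight of |d_(n+1)|^2 once [memory_weight] is set
    aside for the next step. *)
Definition decrease : R :=
  2 - theta - 2 * tau * vt * et - 2 * r / tau - 8 * r * vt
  - 8 * r * vt * (1 + vt) * tau - (2 * r - tau) ^+ 2 / (2 * gamma * tau).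

(** The scalars abstract the norms and inner products of [lyapunov_step]: [ew] is <e, w>, and [P],
    [Q], [S] pair g - g' with w, itself and c. The claim is a nonnegative combination of the
    hypotheses and two further squares, verified by [field]. *)
Lemma scalar_step (beta nu X ee ew eg eg' ec ww wg wg' wc P Q S cc a b k : R) :
    0 < tau -> 0 <= theta -> 0 <= r -> 0 <= vt -> 0 < gamma ->
    beta = gamma + r * (1 + vt) -> ww = a ^+ 2 -> cc = k ^+ 2 ->
    nu * X - r * (ww / tau ^+ 2 + 2 / tau * P - 2 / tau * wc + Q - 2 * S + cc)
      <= (ew - ww) / tau + (eg - wg) - (eg' - wg') - ec + wc ->
    beta * cc <= ec ->
    (1 - theta) * wg' <= (et - 1) * (vt * ww) ->
    - wg <= vt * (a * b) -> P <= vt * (a * (a + b)) ->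
    Q <= (vt * (a + b)) ^+ 2 -> - S <= vt * ((a + b) * k) ->
    0 <= (tau - 2 * r) ^+ 2 * ww - 4 * tau * gamma * (tau - 2 * r) * wc
         + 4 * tau ^+ 2 * gamma ^+ 2 * cc ->
  ee - 2 * theta * ew + theta ^+ 2 * ww + 2 * theta * tau * (eg' - theta * wg')
  <= ee + 2 * theta * tau * eg
     - theta * (decrease + memory_weight) * ww + theta * memory_weight * b ^+ 2
     - 2 * tau * theta * nu * X.
Proof.
move=> t0 th0 r0 v0 g0 -> -> ->.
rewrite -subr_ge0 => h1; rewrite -subr_ge0 => h2; rewrite -subr_ge0 => h3.
rewrite -subr_ge0 => h4; rewrite -subr_ge0 => h5; rewrite -subr_ge0 => h6.
rewrite -subr_ge0 => h7 h8; rewrite -subr_ge0.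
have tt0 : 0 <= 2 * theta * tau by rewrite !mulr_ge0 // ltW.
have tr0 : 0 <= 2 * theta * tau * r by rewrite mulr_ge0.
have c1 := mulr_ge0 tt0 h1; have c2 := mulr_ge0 tt0 h2.
have c3 := mulr_ge0 tt0 h3; have c4 := mulr_ge0 tt0 h4.
have c5 : 0 <= 4 * r * theta * (vt * (a * (a + b)) - P) by rewrite !mulr_ge0.
have c6 := mulr_ge0 tr0 h6; have c7 := mulr_ge0 tr0 h7.
have c8 : 0 <= theta / (2 * tau * gamma) by rewrite divr_ge0 // !mulr_ge0 // ltW.
have {}c8 := mulr_ge0 c8 h8.
have vt1 : 0 <= vt ^+ 2 + vt by rewrite addr_ge0 // sqr_ge0.
(* Young's inequality for all the products [a * b]. *)
have c9 : 0 <= (theta * tau * vt + 2 * r * theta * vt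
    + 2 * tau * r * theta * (vt ^+ 2 + vt)) * (a - b) ^+ 2.
  apply: mulr_ge0; last exact: sqr_ge0.
  by rewrite !addr_ge0 // ?mulr_ge0 // ltW.
(* Splits the product (a + b) k bounding [S]. Its k^2, with the one from semimonotonicity, costs r
   (1 + vt), which leaves gamma out of beta. *)
have c10 : 0 <= 2 * tau * r * theta * vt * (a + b - k) ^+ 2.
  apply: mulr_ge0; last exact: sqr_ge0.
  by rewrite !mulr_ge0 // ltW.
have c67 := addr_ge0 c6 (addr_ge0 c7 c7).
have := addr_ge0 (addr_ge0 (addr_ge0 c1 c2) (addr_ge0 c3 c4))
  (addr_ge0 (addr_ge0 c5 c67) (addr_ge0 c8 (addr_ge0 c9 c10))).
congr (0 <= _); rewrite /decrease /memory_weight; field.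
by rewrite !gt_eqF //.
Qed.

Lemma decrease_gt0 : 0 < tau -> 0 < gamma ->
    0 < (16 * gamma * (- r) * vt * (1 + vt) - 4 * gamma * vt * et - 1) * tau ^+ 2
      + 2 * (gamma * (2 - theta + 8 * (- r) * vt) - 2 * - r) * tau
      + 4 * (- r) * (gamma - - r) ->
  0 < decrease.
Proof.
move=> t0 g0 h.
have := divr_gt0 h (mulr_gt0 (mulr_gt0 (ltr0Sn R 1) g0) t0).
by congr (0 < _); rewrite /decrease; field; rewrite !gt_eqF //.
Qed.

(** Dropping the other nonpositive terms of [decrease] leaves 2 tau vt < 2 - theta, and theta (2 -
    theta) <= 1. *)
Lemma memory_step_small : 0 < tau -> 0 < theta -> 0 <= r -> 0 <= vt -> 0 < gamma ->
  1 <= et -> 0 < decrease -> 2 * (theta * tau * vt) < 1.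
Proof.
move=> t0 th0 r0 v0 g0 e1 d0.
have h1 : 0 <= 2 * r / tau by rewrite divr_ge0 ?mulr_ge0 // ltW.
have h2 : 0 <= 8 * r * vt by rewrite !mulr_ge0.
have h3 : 0 <= 8 * r * vt * (1 + vt) * tau by rewrite !mulr_ge0 ?addr_ge0 // ltW.
have h4 : 0 <= (2 * r - tau) ^+ 2 / (2 * gamma * tau).
  by rewrite divr_ge0 ?sqr_ge0 // !mulr_ge0 // ltW.
have h5 : 0 <= tau * vt * (et - 1) by rewrite !mulr_ge0 ?subr_ge0 // ltW.
have h6 : 2 * tau * vt < 2 - theta by move: d0; rewrite /decrease; lra.
have h7 := mulr_gt0 th0 (_ : 0 < 2 - theta - 2 * tau * vt).
have := sqr_ge0 (theta - 1); have := h7 ltac:(lra); lra.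
Qed.

End Rate.

(** * Subsequences and monotone descent *)

Lemma cvg_subsequence (T : topologicalType) (u : nat -> T) (l : T) (s : nat -> nat) :
  (forall k, (k <= s k)%N) -> u @ \oo --> l -> u \o s @ \oo --> l.
Proof.
move=> sk; apply: cvg_comp; apply/cvgnyPge => N; exists N => // k /= Nk.
exact: leq_trans (sk k).
Qed.

Lemma descent_cvg (R : realType) (L q : nat -> R) (d : R) : 0 < d ->
    (forall n, 0 <= L n) -> (forall n, 0 <= q n) ->
    (forall n, L n.+1 <= L n - d * q n) ->
  cvgn L /\ q @ \oo --> 0.
Proof.
move=> d0 L0 q0 dec.
have cL : cvgn L.
  apply: nonincreasing_is_cvgn; last by exists 0 => _ [n _ <-].
  apply/nonincreasing_seqP => n; rewrite (le_trans (dec n))// lerBlDr lerDl.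
  by rewrite mulr_ge0// ltW.
split=> //.
have cD : d^-1 * (L n - L n.+1) @[n --> \oo] --> 0.
  rewrite -(mulr0 d^-1) -(subrr (limn L)); apply: cvgMr; apply: cvgB => //.
  by rewrite (cvg_shiftS L).
apply: squeeze_cvgr (cvg_cst 0) cD; near=> n; rewrite q0/=.
by rewrite mulrC ler_pdivlMr//; have := dec n; lra.
Unshelve. all: by end_near. Qed.

(** * Opial's argument and the Lyapunov inequality *)

Section Opial.
Context {R : realType} {H : completeNormedModType R}.
Context (dot : {dot H for (@idfun R)}).
Hypothesis hdot : hilbert_dot dot.

Lemma weak_cvg_cvg0 (x d : nat -> H) (l : H) :
  weak_cvg dot x l -> d @ \oo --> 0 -> weak_cvg dot (fun n => x n - d n) l.
Proof.
move=> xl d0 w; rewrite -(subr0 (dot l w)) -{1}(dot0l dot w).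
under eq_fun do rewrite !dotE.
by apply: cvgB; [exact: xl|exact: dot_cvg].
Qed.

Lemma opial (Z : set H) (z : nat -> H) (M : R) :
    (forall n, `|z n| <= M) ->
    (forall x, Z x -> cvgn (fun n => `|z n - x| ^+ 2)) ->
    (forall (s : nat -> nat) l, (forall k, (k <= s k)%N) ->
       weak_cvg dot (z \o s) l -> Z l) ->
  exists l, Z l /\ weak_cvg dot z l.
Proof.
move=> zM Zc Zs.
have [s [l [sk zl]]] := weak_seq_compact hdot zM.
have Zl := Zs _ _ sk zl.
exists l; split=> // w; apply: contrapT => /cvgrPdist_lt.
move=> /existsNP[e /not_implyP[e0 nc]].
(* If convergence fails at [w], arbitrarily late indices stay at distance [e]; a weak cluster point
   of these is compared with [l]. *)
have /choice[t tP] (N : nat) : exists n, (N <= n)%N /\ e <= `|dot l w - dot (z n) w|.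
  apply: contrapT => /forallNP h; apply: nc; exists N => // n /= Nn.
  by rewrite ltNge; apply/negP => ?; apply: (h n).
have [s' [l' [s'k zl']]] := weak_seq_compact hdot (fun n => zM (t n)).
have tsk k : (k <= t (s' k))%N.
  by rewrite (leq_trans (s'k k))//; have [] := tP (s' k).
have Zl' := Zs _ _ tsk zl'.
(* The squared norms of z_n cancel, so the convergent [D n] equals 2 <z_n, l' - l>. Its limits along
   the two subsequences agree, whence |l' - l|^2 = 0. *)
pose D n := `|z n - l| ^+ 2 - `|z n - l'| ^+ 2 + (dot l' l' - dot l l).
have DE n : D n = 2 * dot (z n) (l' - l).
  by rewrite /D -!hdot !dotE (dotC _ l (z n)) (dotC _ l' (z n)); ring.
have [d Dd] : exists d : R, D n @[n --> \oo] --> d.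
  eexists; apply: cvgD; last exact: cvg_cst.
  by apply: cvgB; [exact: Zc Zl|exact: Zc Zl'].
have lim_unique (r : nat -> nat) m : (forall k, (k <= r k)%N) ->
    weak_cvg dot (z \o r) m -> d = 2 * dot m (l' - l).
  move=> rk zm; have h1 : D (r k) @[k --> \oo] --> d by exact: cvg_subsequence rk Dd.
  have h2 : D (r k) @[k --> \oo] --> 2 * dot m (l' - l).
    by under eq_fun do rewrite DE; apply: cvgMr; exact: zm.
  exact: cvg_unique h1 h2.
have ll' : l' - l = 0.
  apply/eqP; rewrite -normr_eq0 -sqrf_eq0 -hdot dotDl dotNl.
  have := lim_unique _ _ sk zl; rewrite (lim_unique _ _ tsk zl') => h.
  by rewrite (mulfI _ h) ?subrr// pnatr_eq0.
have := zl' w; rewrite (subr0_eq ll') => /cvgrPdist_lt/(_ _ e0)/filter_ex[k].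
by rewrite ltNge; have [_ ->] := tP (s' k).
Qed.

(* The quantity bounded here is [|z_n - z*|^2 + 2 theta tau <z_n - z*, g_n>]
   with [e = z_n - z*], [w = z_n - p_(n+1)], [c = C z_n - C z*],
   [g = D z_(n-1) - D p_n], [g' = D z_n - D p_(n+1)]. *)
Lemma lyapunov_step (tau theta r beta gamma vt et nu b : R) (e w g g' c : H) :
    0 < tau -> 0 <= theta -> 0 <= r -> 0 <= vt -> 0 < gamma ->
    beta = gamma + r * (1 + vt) ->
    `|g| <= vt * b -> `|g'| <= vt * `|w| ->
    (1 - theta) * dot w g' <= (et - 1) * (vt * `|w| ^+ 2) ->
    beta * `|c| ^+ 2 <= dot e c ->
    nu * `|e - w| ^+ 2 - r * `|tau^-1 *: w + g - g' - c| ^+ 2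
      <= dot (e - w) (tau^-1 *: w + g - g' - c) ->
  `|e - theta *: w| ^+ 2 + 2 * theta * tau * dot (e - theta *: w) g'
  <= `|e| ^+ 2 + 2 * theta * tau * dot e g
     - theta * (decrease tau theta r gamma vt et + memory_weight tau r vt)
         * `|w| ^+ 2
     + theta * memory_weight tau r vt * b ^+ 2
     - 2 * tau * theta * nu * `|e - w| ^+ 2.
Proof.
move=> t0 th0 r0 v0 g0 hbeta gb g'w hw hc hs.
have gg' : `|g - g'| <= vt * (`|w| + b).
  by rewrite (le_trans (ler_normB _ _))// mulrDr addrC lerD.
(* Completes the square: multiplied by theta / (2 tau gamma), it cancels the <w, c> term and uses up
   exactly the gamma |c|^2 left by cocoercivity. *)
have h8 := dot_ge0 hdot ((tau - 2 * r) *: w - (2 * tau * gamma) *: c).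
have -> : `|e - theta *: w| ^+ 2 + 2 * theta * tau * dot (e - theta *: w) g' =
    `|e| ^+ 2 - 2 * theta * dot e w + theta ^+ 2 * `|w| ^+ 2 +
    2 * theta * tau * (dot e g' - theta * dot w g').
  by rewrite -!hdot !dotE (dotC _ w e); ring.
apply: (@scalar_step _ tau theta r gamma vt et beta nu (`|e - w| ^+ 2)
  (`|e| ^+ 2) (dot e w) (dot e g) (dot e g') (dot e c) (`|w| ^+ 2) (dot w g)
  (dot w g') (dot w c) (dot w (g - g')) (dot (g - g') (g - g')) (dot (g - g') c)
  (`|c| ^+ 2) `|w| b `|c|) => //.
- move: hs; rewrite -!hdot.
  congr (_ <= _); rewrite !dotE.
    rewrite (dotC _ g w) (dotC _ g' w) (dotC _ c w) (dotC _ g' g) (dotC _ c g).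
    by rewrite (dotC _ c g'); field; rewrite gt_eqF.
  by field; rewrite gt_eqF.
- rewrite -dotNr (le_trans (dot_ler hdot _ _))// normrN mulrCA.
  by rewrite ler_wpM2l.
- rewrite (le_trans (dot_ler hdot _ _))// mulrCA.
  by rewrite ler_wpM2l.
- by rewrite hdot lerXn2r// nnegrE ?normr_ge0// (le_trans (normr_ge0 (g - g'))).
- rewrite -dotNl (le_trans (dot_ler hdot _ _))// normrN mulrA.
  by rewrite ler_wpM2r.
- move: h8; rewrite -!hdot; congr (0 <= _).
  by rewrite !dotE (dotC _ c w); ring.
Qed.

End Opial.

(** * Convergence rates and two-sided bounds on the functional *)

Lemma cvg0_dominated (R : realType) (U V : normedModType R) (u : nat -> U)
    (v : nat -> V) (K : R) :
  (forall n, `|u n| <= K * `|v n|) -> v @ \oo --> 0 -> u @ \oo --> 0.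
Proof.
move=> uv v0; apply/norm_cvg0P.
have Kv : K * `|v n| @[n --> \oo] --> 0.
  by rewrite -(mulr0 K); apply: cvgMr; apply/norm_cvg0P.
by apply: squeeze_cvgr (cvg_cst 0) Kv; near=> n; rewrite normr_ge0 uv.
Unshelve. all: by end_near. Qed.

Lemma sqr_norm_cvg0 (R : realType) (U : normedModType R) (u : nat -> U) :
  `|u n| ^+ 2 @[n --> \oo] --> 0 -> u @ \oo --> 0.
Proof.
move=> /cvgr0Pnorm_lt h; apply/cvgr0Pnorm_lt => e e0.
apply: filterS (h _ (exprn_gt0 2 e0)) => n.
by rewrite ger0_norm ?sqr_ge0// ltr_pXn2r// ?nnegrE ?(ltW e0).
Qed.

(** Adding [d] times the first bound to [K] times the second eliminates [Q]: (K + d) L_(n+1) <= K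
    L_n. *)
Lemma geometric_decay (R : realFieldType) (L Q : nat -> R) (K d : R) :
    0 < K -> 0 < d -> (forall n, 0 <= L n) ->
    (forall n, L n.+1 <= K * Q n) -> (forall n, L n.+1 <= L n - d * Q n) ->
  forall n, L n <= L 0%N * (K / (K + d)) ^+ n.
Proof.
move=> K0 d0 L0 LK Ld; elim=> [|n IH]; first by rewrite expr0 mulr1.
have Kd : 0 < K + d by rewrite addr_gt0.
rewrite exprSr mulrA; apply: le_trans (ler_wpM2r _ IH).
  have h1 : d * L n.+1 <= d * (K * Q n) by rewrite ler_pM2l.
  have h2 : K * L n.+1 <= K * (L n - d * Q n) by rewrite ler_pM2l.
  by rewrite mulrA ler_pdivlMr//; lra.
by rewrite divr_ge0 ?ltW.
Qed.

Lemma Rlinear_cvg_sqr (R : realType) (H : completeNormedModType R)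
    (z : nat -> H) (l : H) (c q : R) : 0 < q < 1 ->
  (forall n, `|z n - l| ^+ 2 <= c * q ^+ n) -> Rlinear_cvg z l.
Proof.
move=> /andP[q0 q1] zc.
have c0 : 0 <= c by have := zc 0%N; rewrite expr0 mulr1; apply: le_trans (sqr_ge0 _).
exists (Num.sqrt c), (Num.sqrt q); split; rewrite ?sqrtr_ge0//.
  by rewrite sqrtr_gt0 q0/= -[ltRHS]sqrtr1 ltr_sqrt.
move=> n; rewrite -(@ler_pXn2r _ 2)// ?nnegrE ?mulr_ge0 ?exprn_ge0 ?sqrtr_ge0//.
by rewrite exprMn sqr_sqrtr// exprAC sqr_sqrtr// ltW.
Qed.

(** Lower bound of the functional, with a = |e_n|, b = |d_n|, x = theta tau <e_n, g_n>: use 2 s a b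
    <= s (a^2 + b^2), s < 1/2 and s <= m. *)
Lemma cross_term_absorbed (R : realFieldType) (s a b m x : R) :
  0 <= s -> 2 * s < 1 -> s <= m -> - (s * (a * b)) <= x ->
  a ^+ 2 / 2 <= a ^+ 2 + 2 * x + m * b ^+ 2.
Proof.
move=> s0 s1 sm hx.
have h1 : 0 <= (1 - 2 * s) * a ^+ 2 by rewrite mulr_ge0 ?sqr_ge0// subr_ge0 ltW.
have h2 : 0 <= s * (a - b) ^+ 2 by rewrite mulr_ge0 ?sqr_ge0.
have h3 : 0 <= (m - s) * b ^+ 2 by rewrite mulr_ge0 ?sqr_ge0// subr_ge0.
lra.
Qed.

(** Upper bound of the functional by the quantities it loses in one step, P = |p_(n+1) - z*| and W =
    |d_(n+1)|: as 2 s < 1, the cross term is at most a W. *)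
Lemma cross_term_bounded (R : realFieldType) (s P W a m x : R) :
  0 <= s -> 2 * s < 1 -> 0 <= m -> 0 <= P -> 0 <= W ->
  0 <= a <= P + W -> x <= s * (a * W) ->
  a ^+ 2 + 2 * x + m * W ^+ 2 <= (4 + m) * (P ^+ 2 + W ^+ 2).
Proof.
move=> s0 s1 m0 P0 W0 /andP[a0 aPW] hx.
have h1 : a ^+ 2 <= (P + W) ^+ 2 by rewrite lerXn2r// nnegrE addr_ge0.
have h2 : a * W <= (P + W) * W by rewrite ler_wpM2r.
have h3 : 0 <= (1 - 2 * s) * (a * W) by rewrite mulr_ge0 ?mulr_ge0// subr_ge0 ltW.
have h4 : 0 <= m * P ^+ 2 by rewrite mulr_ge0 ?sqr_ge0.
have h5 := sqr_ge0 (P - W); have h6 := sqr_ge0 P; have h7 := sqr_ge0 W.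
lra.
Qed.

(** * Zeros and resolvents of sums of operators *)

Section Operators.
Context {R : realType} {H : completeNormedModType R}.
Implicit Types (A : H -> set H) (C D : H -> H).

Lemma zerE A C D x :
  zer (opadd (opadd A (op_of C)) (op_of D)) x <-> opadd A (op_of D) x (- C x).
Proof.
split.
  move=> [_ [a Aa [_ -> <-]] [_ -> /= acd]].
  by exists a => //; exists (D x) => //; apply/eqP; rewrite -addr_eq0 addrAC acd.
move=> [a Aa [_ -> ad]].
exists (a + C x); first by exists a => //; exists (C x).
by exists (D x) => //; rewrite addrAC ad addNr.
Qed.

Lemma opaddAC A C D :
  opadd (opadd A (op_of D)) (op_of C) = opadd (opadd A (op_of C)) (op_of D).
Proof.
by apply/funext => x; apply/seteqP; split=> _ [_ [a Aa [_ -> <-]] [_ -> <-]];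
  rewrite addrAC; (eexists; last by eexists; last by []); exists a => //; eexists.
Qed.

Lemma resolvent_scale A (tau : R) (x p : H) : 0 < tau ->
  resolvent (opscale tau A) x p -> A p (tau^-1 *: (x - p)).
Proof.
move=> t0 [_ -> [_ [a Aa <-] <-]].
by rewrite addrC addKr scalerA mulVf ?scale1r// gt_eqF.
Qed.

End Operators.

(** For uniqueness of the zero: chaining through [T] gives nu X <= -(beta + rho) Y <= 0. *)
Lemma strong_gap_eq0 (R : realFieldType) (nu rho beta X Y T : R) :
  0 < nu -> 0 <= beta + rho -> 0 <= X -> 0 <= Y ->
  nu * X + rho * Y <= - T -> beta * Y <= T -> X = 0.
Proof.
move=> nu0 br X0 Y0 h1 h2; apply/eqP; rewrite eq_le X0 andbT -(pmulr_rle0 _ nu0).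
by have := mulr_ge0 br Y0; lra.
Qed.

(** * The iteration: Lyapunov functional and both convergence statements *)

Theorem proposition4p17
  (R : realType) (H : completeNormedModType R) (dot : {dot H for (@idfun R)})
  (hdot : hilbert_dot dot)
  (A : H -> set H) (C D : H -> H) (beta vartheta : R)
  (hbeta : 0 < beta) (hC : cocoercive dot beta C)
  (hvartheta : 0 <= vartheta) (hD : vartheta.-lipschitz D)
  (hzer : zer (opadd (opadd A (op_of C)) (op_of D)) !=set0)
  (rhoA nuA : R) (hnuA : 0 <= nuA)
  (ha : semimonotone_on dot nuA rhoA (opadd A (op_of D))
          [set (xs, - C xs) | xs in [set xs | opadd A (op_of D) xs (- C xs)]])
  (OmegaA : set R) (hOmegaA : OmegaA `<=` [set t | 0 < t])
  (hb : forall t, OmegaA t ->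
          single_valued (resolvent (opscale t A)) /\
          opdom (resolvent (opscale t A)) = setT)
  (hc : seq_weak_strong_closed dot
          (gra (opadd (opadd A (op_of D)) (op_of C))))
  (tau theta rhohat : R)
  (htau : OmegaA tau) (htheta : 0 < theta < 2)
  (hrhohat : rhohat = Num.min 0 rhoA)
  (zm1 ym1 : H) (y x p z : nat -> H)
  (hym1 : ym1 = D zm1)
  (hrec : forall n : nat,
     [/\ y n = D (z n),
         x n = z n - tau *: (y n - prev_term ym1 y n + D (p n) + C (z n)),
         resolvent (opscale tau A) (x n) (p n.+1) &
         z n.+1 = (1 - theta) *: z n + theta *: p n.+1])
  (gamma b0 b1 b2 : R)
  (hgamma : gamma = beta + rhohat * (1 + vartheta))
  (hgamma_gt0 : 0 < gamma)
  (hb0 : b0 = 4 * rhohat * (gamma - rhohat))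
  (hb1 : b1 = 2 * (gamma * (2 - theta + 8 * rhohat * vartheta) - 2 * rhohat))
  (hb2 : b2 = 16 * gamma * rhohat * vartheta * (1 + vartheta)
              - 4 * gamma * vartheta * eta dot D theta - 1)
  (hquad : 0 < b2 * tau ^+ 2 + b1 * tau + b0) :
  (exists zl, zer (opadd (opadd A (op_of C)) (op_of D)) zl /\
              weak_cvg dot z zl) /\
  (0 < nuA ->
     exists zl, zer (opadd (opadd A (op_of C)) (op_of D)) = [set zl] /\
                Rlinear_cvg z zl).
Proof.
have t0 : 0 < tau by exact: hOmegaA htau.
have [th0 th2] := andP htheta.
pose r := - rhohat.
have r0 : 0 <= r by rewrite /r hrhohat oppr_ge0 ge_min lexx.
have rhoE : rhohat = - r by rewrite /r opprK.
have betaE : beta = gamma + r * (1 + vartheta) by rewrite hgamma rhoE; ring.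
set et := eta dot D theta in hb2.
have et1 : 1 <= et.
  by rewrite /et /eta; case: ifP => // _; rewrite lerDl normr_ge0.
have kap0 : 0 < decrease tau theta r gamma vartheta et.
  by apply: decrease_gt0 => //; move: hquad; rewrite hb0 hb1 hb2 rhoE.
set kap := decrease _ _ _ _ _ _ in kap0.
have small := memory_step_small t0 th0 r0 hvartheta hgamma_gt0 et1 kap0.
have lipD a b : `|D a - D b| <= vartheta * `|a - b| by exact: (hD (a, b)).
have lipC a b : `|C a - C b| <= beta^-1 * `|a - b|.
  have [->|] := eqVneq (C a - C b) 0.
    by rewrite normr0 mulr_ge0// invr_ge0 ltW.
  rewrite -normr_gt0 => Cab; rewrite ler_pdivlMl// -(ler_pM2r Cab) -mulrA.
  exact: le_trans (hC a b) (dot_ler hdot _ _).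
(* Indices are shifted: [d 0] and [g 0] come from the free initial data z_(-1), p_0, and only
   [d n.+1] is tied to an iteration. *)
pose d n := prev_term zm1 z n - p n.
pose g n := D (prev_term zm1 z n) - D (p n).
have gd n : `|g n| <= vartheta * `|d n| by exact: lipD.
have dS n : d n.+1 = z n - p n.+1 by [].
have zS n : z n.+1 = z n - theta *: d n.+1.
  have [_ _ _ ->] := hrec n.
  by rewrite dS scalerBr scalerBl scale1r opprB addrA addrAC.
pose u n := tau^-1 *: d n.+1 + g n - g n.+1 - C (z n).
(* The resolvent puts (x_n - p_(n+1)) / tau in A p_(n+1); adding D p_(n+1) turns the D terms into
   g_n - g_(n+1). *)
have Au n : opadd A (op_of D) (p n.+1) (u n).
  have [hy hx /(resolvent_scale t0) Ap _] := hrec n.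
  exists (tau^-1 *: (x n - p n.+1)) => //; exists (D (p n.+1)) => //.
  have yprev : prev_term ym1 y n = D (prev_term zm1 z n).
    by case: n {Ap hx hy} => [//|n]; have [] := hrec n.
  rewrite hx addrAC -dS scalerBr scalerA mulVf ?gt_eqF// scale1r hy yprev.
  rewrite /u /g !opprD !opprK !addrA.
  by rewrite [LHS](ACl (1*3*4*2*6*5)).
have semi zs n : opadd A (op_of D) zs (- C zs) ->
    nuA * `|p n.+1 - zs| ^+ 2 - r * `|u n + C zs| ^+ 2
      <= dot (p n.+1 - zs) (u n + C zs).
  move=> hz.
  have hS : [set (xs, - C xs) | xs in [set xs | opadd A (op_of D) xs (- C xs)]]
      (zs, - C zs) by exists zs.
  have := ha _ _ _ _ hS (Au n : gra _ (p n.+1, u n)); rewrite opprK; apply: le_trans.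
  rewrite lerD2l -mulNr -rhoE ler_wpM2r ?sqr_ge0//.
  by rewrite hrhohat ge_min lexx orbT.
set k2 := memory_weight tau r vartheta.
have k20 : 0 <= k2.
  by rewrite /k2 /memory_weight !addr_ge0// !mulr_ge0// ?addr_ge0// ltW.
pose L zs n := `|z n - zs| ^+ 2 + 2 * (theta * tau * dot (z n - zs) (g n))
  + theta * k2 * `|d n| ^+ 2.
have Lstep zs n : opadd A (op_of D) zs (- C zs) ->
    L zs n.+1 <= L zs n - (theta * kap * `|d n.+1| ^+ 2
      + 2 * tau * theta * nuA * `|p n.+1 - zs| ^+ 2).
  move=> hz.
  have ewE : z n - zs - d n.+1 = p n.+1 - zs.
    by rewrite dS opprB addrACA [- zs - _]addrC addrACA subrr add0r.
  have eS : z n - zs - theta *: d n.+1 = z n.+1 - zs by rewrite addrAC zS.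
  have uE : tau^-1 *: d n.+1 + g n - g n.+1 - (C (z n) - C zs) = u n + C zs.
    by rewrite [- (C _ - _)]opprB [C zs - _]addrC addrA.
  have mono : (1 - theta) * dot (d n.+1) (g n.+1)
      <= (et - 1) * (vartheta * `|d n.+1| ^+ 2).
    have dg : `|dot (d n.+1) (g n.+1)| <= vartheta * `|d n.+1| ^+ 2.
      rewrite (le_trans (norm_dot_le hdot _ _))// expr2 mulrCA.
      by rewrite ler_wpM2l.
    (* The two cases of eta: for theta >= 1 and D monotone the left side is nonpositive; otherwise
       it is at most |1 - theta| times the Lipschitz bound. *)
    rewrite /et /eta; case: ifPn => [/asboolP[/andP[th1 _] Dm]|_].
      by rewrite subrr mul0r mulr_le0_ge0 ?subr_le0//; exact: Dm.
    rewrite [1 + _ - 1]addrAC subrr add0r (le_trans (ler_norm _))// normrM.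
    by rewrite ler_wpM2l.
  have := @lyapunov_step _ _ _ hdot tau theta r beta gamma vartheta et nuA (`|d n|)
    (z n - zs) (d n.+1) (g n) (g n.+1) (C (z n) - C zs).
  rewrite ewE eS uE => /(_ t0 (ltW th0) r0 hvartheta hgamma_gt0 betaE (gd n)
    (gd n.+1) mono (hC (z n) zs) (semi zs n hz)).
  rewrite -subr_ge0 => step; rewrite -subr_ge0; move: step.
  by congr (0 <= _); rewrite /L -/kap -/k2; ring.
have Lge zs n : `|z n - zs| ^+ 2 / 2 <= L zs n.
  apply: (@cross_term_absorbed _ (theta * tau * vartheta) _ `|d n|) => //.
  - by rewrite !mulr_ge0// ltW.
  - rewrite /k2 /memory_weight -mulrA ler_pM2l// -addrA lerDl.
    by rewrite addr_ge0// !mulr_ge0// ?addr_ge0// ltW.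
  - rewrite lerNl -mulrN -dotNr -!mulrA ler_pM2l// ler_pM2l//.
    rewrite (le_trans (dot_ler hdot _ _))// normrN mulrCA.
    by rewrite ler_wpM2l.
have L0 zs n : 0 <= L zs n.
  by rewrite (le_trans _ (Lge zs n))// divr_ge0 ?sqr_ge0.
have LK zs n : L zs n.+1 <= (4 + theta * k2) * (`|p n.+1 - zs| ^+ 2 + `|d n.+1| ^+ 2).
  apply: (@cross_term_bounded _ (theta * tau * vartheta)) => //.
  - by rewrite !mulr_ge0// ltW.
  - by rewrite mulr_ge0// ltW.
  - rewrite normr_ge0/= zS.
    (* The relaxation leaves a multiple of d_(n+1) with |1 - theta| <= 1. *)
    have -> : z n - theta *: d n.+1 - zs = p n.+1 - zs + (1 - theta) *: d n.+1.
      rewrite scalerBl scale1r addrA [p n.+1 - zs + _]addrAC dS.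
      by rewrite [p n.+1 + _]addrC subrK addrAC.
    rewrite (le_trans (ler_normD _ _))// lerD2l normrZ ler_piMl// ler_norml.
    by apply/andP; split; lra.
  - rewrite -!mulrA ler_pM2l// ler_pM2l//.
    by rewrite (le_trans (dot_ler hdot _ _))// mulrCA ler_wpM2l.
have [zs /zerE hzs] := hzer.
have tk0 : 0 < theta * kap by rewrite mulr_gt0.
have Ldesc z' n : opadd A (op_of D) z' (- C z') ->
    L z' n.+1 <= L z' n - theta * kap * `|d n.+1| ^+ 2.
  move=> /Lstep/le_trans -> //; rewrite lerD2l lerN2 lerDl.
  by rewrite !mulr_ge0// ltW.
have Lcvg z' : opadd A (op_of D) z' (- C z') ->
    cvgn (L z') /\ `|d n.+1| ^+ 2 @[n --> \oo] --> 0.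
  by move=> hz; apply: (descent_cvg tk0) => // n; exact: Ldesc.
have d0 : d n @[n --> \oo] --> 0.
  by rewrite -cvg_shiftS; apply: sqr_norm_cvg0; exact: (Lcvg _ hzs).2.
have dS0 : d n.+1 @[n --> \oo] --> 0 by rewrite (cvg_shiftS d).
have g0 : g n @[n --> \oo] --> 0 := cvg0_dominated gd d0.
have Lbnd z' n : opadd A (op_of D) z' (- C z') -> L z' n <= L z' 0%N.
  move=> hz; elim: n => // n; apply: le_trans.
  by rewrite (le_trans (Ldesc _ _ hz))// lerBlDr lerDl mulr_ge0 ?sqr_ge0// ltW.
have dist_bnd z' : opadd A (op_of D) z' (- C z') ->
    forall n, `|z n - z'| <= Num.sqrt (2 * L z' 0%N).
  move=> hz n; rewrite -(@ler_pXn2r _ 2)// ?nnegrE ?sqrtr_ge0//.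
  rewrite sqr_sqrtr ?mulr_ge0// mulrC -ler_pdivrMr//.
  exact: le_trans (Lge _ _) (Lbnd _ _ hz).

(* Weak convergence *)
split.
  apply: (@opial _ _ _ hdot _ z (Num.sqrt (2 * L zs 0%N) + `|zs|)).
  - move=> n; rewrite -[z n](subrK zs) (le_trans (ler_normD _ _))// lerD2r.
    exact: dist_bnd.
  - move=> z' /zerE hz.
    (* Boundedness of z_n and g_n -> 0 remove the cross term, so |z_n - z'|^2 converges because the
       functional does. *)
    have cross : dot (z n - z') (g n) @[n --> \oo] --> 0.
      have h : forall n, `|dot (z n - z') (g n)| <= Num.sqrt (2 * L z' 0%N) * `|g n|.
        move=> n; rewrite (le_trans (norm_dot_le hdot _ _))// ler_wpM2r//.
        exact: dist_bnd.
      exact: (cvg0_dominated h g0).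
    have -> : (fun n => `|z n - z'| ^+ 2) = (fun n => L z' n
       - 2 * theta * tau * dot (z n - z') (g n) - theta * k2 * (`|d n| * `|d n|)).
      by apply/funext => n; rewrite /L; ring.
    have nd : `|d n| @[n --> \oo] --> 0 by apply/norm_cvg0P.
    apply/cvg_ex; eexists; apply: cvgB.
      by apply: cvgB; [exact: (Lcvg _ hz).1|apply: cvgMr; exact: cross].
    by apply: cvgMr; apply: cvgM; exact: nd.
  - move=> s l sk zl.
    (* [e n] belongs to (A + D + C) p_(n+1) and tends to 0, while p_(n+1) = z_n - d_(n+1) has the
       weak cluster points of z_n; closedness of the graph applies. *)
    pose e n := u n + C (p n.+1).
    have e0 : e n @[n --> \oo] --> 0.
      have eE n : e n = tau^-1 *: d n.+1 + g n - g n.+1 - (C (z n) - C (p n.+1)).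
        by rewrite /e /u [- (C _ - _)]opprB [C (p _) - _]addrC [_ + (- C _ + _)]addrA.
      under eq_fun do rewrite eE.
      have lim : tau^-1 *: d n.+1 + g n - g n.+1 - (C (z n) - C (p n.+1))
          @[n --> \oo] --> tau^-1 *: 0 + 0 - 0 - 0.
        apply: cvgB; last exact: (cvg0_dominated (fun n => lipC (z n) (p n.+1)) dS0).
        apply: cvgB; last by rewrite (cvg_shiftS g).
        by apply: cvgD => //; exact: cvgZr.
      by rewrite scaler0 !subr0 addr0 in lim.
    have : gra (opadd (opadd A (op_of D)) (op_of C)) (l, 0).
      apply: (hc (fun k => p (s k).+1) (fun k => e (s k))).
      + by move=> n; exists (u (s n)); [exact: Au|exists (C (p (s n).+1))].
      + have -> : (fun k => p (s k).+1) = (fun k => (z \o s) k - d (s k).+1).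
          by apply/funext => k; rewrite dS /= subKr.
        exact: (weak_cvg_cvg0 hdot zl (cvg_subsequence sk dS0)).
      + exact: (cvg_subsequence sk e0).
    by rewrite opaddAC.

(* Uniqueness of the zero and R-linear convergence *)
move=> nu0; exists zs; split.
  apply/seteqP; split=> [z' /zerE hz'|_ ->]; last exact/zerE.
  have hS : [set (xs, - C xs) | xs in [set xs | opadd A (op_of D) xs (- C xs)]]
      (zs, - C zs) by exists zs.
  have := ha _ _ _ _ hS (hz' : gra _ (z', - C z')).
  rewrite (_ : - C z' - - C zs = - (C z' - C zs)); last by rewrite opprB opprK addrC.
  rewrite dotNr normrN => h.
  (* Indeed beta + rhohat = gamma + r vartheta. *)
  have rho_ge : 0 <= beta + rhoA.
    rewrite (@le_trans _ _ (beta + rhohat))//; last first.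
      by rewrite lerD2l hrhohat ge_min lexx orbT.
    by rewrite rhoE betaE mulrDr mulr1 addrA addrAC addrK addr_ge0 ?mulr_ge0// ltW.
  apply/eqP; rewrite -subr_eq0 -normr_eq0 -sqrf_eq0; apply/eqP.
  exact: (strong_gap_eq0 nu0 rho_ge (sqr_ge0 _) (sqr_ge0 _) h (hC z' zs)).
(* [dl] is the smaller of the two decrease coefficients, so one step loses at least [dl] times the
   sum that [K] compares with the functional. *)
pose K := 4 + theta * k2; pose dl := Num.min (theta * kap) (2 * tau * theta * nuA).
have dl0 : 0 < dl by rewrite lt_min tk0 !mulr_gt0.
have K0 : 0 < K by rewrite ltr_wpDr// mulr_ge0// ltW.
have LQ n : L zs n.+1 <= L zs n - dl * (`|p n.+1 - zs| ^+ 2 + `|d n.+1| ^+ 2).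
  rewrite (le_trans (Lstep _ n hzs))// lerD2l lerN2 mulrDr addrC.
  by rewrite lerD// ler_wpM2r ?sqr_ge0// /dl ge_min lexx ?orbT.
have decay := geometric_decay K0 dl0 (L0 zs) (LK zs) LQ.
apply: (@Rlinear_cvg_sqr _ _ _ _ (2 * L zs 0%N) (K / (K + dl))).
  have Kd0 : 0 < K + dl by rewrite addr_gt0.
  by apply/andP; split; [rewrite divr_gt0|rewrite ltr_pdivrMr// mul1r ltrDl].
move=> n; rewrite -mulrA mulrC -ler_pdivrMr//.
exact: le_trans (Lge _ _) (decay n).
Qed.
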